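(* In a constructive meta-theory, assuming $\mathsf{DC}$, $\mathsf{BDP}$ and $\mathsf{BEP}$, the downward Löwenheim–Skolem theorem $\mathsf{DLS}$ holds.
   Context: Meta-theory: constructive higher-order logic with propositions $\mathbb P$ and $\mathbb N$; excluded middle is not assumed. A type $A$ is countable if there are $i:A\to\mathbb N$, $j:\mathbb N\to A$ with $j(i\,x)=x$ (finite included). First-order logic without equality; models are types with interpretations of symbols; $\mathcal M\vDash_\rho\phi$ is Tarski satisfaction for $\rho:\mathbb N\to\mathcal M$. An elementary embedding $h:\mathcal N\to\mathcal M$ satisfies $\mathcal N\vDash_\rho\phi\leftrightarrow\mathcal M\vDash_{h\circ\rho}\phi$ for all $\rho,\phi$. $\mathsf{DLS}$: for every signature with countably many symbols and every model $\mathcal M$, there are a model $\mathcal N$ with countable domain and an elementary embedding $\mathcal N\to\mathcal M$. - $\mathsf{DC}$: for every inhabited $A$ and $R:A\to A\to\mathbb P$ with $\forall x\exists y.\,R\,x\,y$, there is $f:\mathbb N\to A$ with $\forall n.\,R(f\,n)(f(n+1))$. - $\mathsf{BDP}$: for every inhabited $A$ and $P:A\to\mathbb P$ there is $f:\mathbb N\to A$ with $(\forall n.\,P(f\,n))\to\forall x.\,P\,x$. - $\mathsf{BEP}$: for every inhabited $A$ and $P:A\to\mathbb P$ there is $f:\mathbb N\to A$ with $(\exists x.\,P\,x)\to\exists n.\,P(f\,n)$. *)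

(* Defs.v *)
From Stdlib Require Import Vector.

Set Implicit Arguments.
Unset Strict Implicit.

Definition DC : Prop :=
  forall (A : Type) (R : A -> A -> Prop),
    inhabited A ->
    (forall x, exists y, R x y) ->
    exists f : nat -> A, forall n, R (f n) (f (S n)).

Definition BDP : Prop :=
  forall (A : Type) (P : A -> Prop),
    inhabited A ->
    exists f : nat -> A, (forall n, P (f n)) -> forall x, P x.

Definition BEP : Prop :=
  forall (A : Type) (P : A -> Prop),
    inhabited A ->
    exists f : nat -> A, (exists x, P x) -> exists n, P (f n).

Definition countable (A : Type) : Prop :=
  exists (i : A -> nat) (j : nat -> A), forall x, j (i x) = x.

Record signature : Type := Signature {
  fun_sym : Type;
  fun_ar : fun_sym -> nat;
  pred_sym : Type;
  pred_ar : pred_sym -> nat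
}.

Inductive term (Sg : signature) : Type :=
| var (n : nat)
| func (f : fun_sym Sg) (ts : Vector.t (term Sg) (fun_ar f)).

(* Variables are de Bruijn indices: index 0 is bound by the nearest
   enclosing quantifier. *)
Inductive form (Sg : signature) : Type :=
| bot
| atom (P : pred_sym Sg) (ts : Vector.t (term Sg) (pred_ar P))
| and_ (phi psi : form Sg)
| or_ (phi psi : form Sg)
| imp (phi psi : form Sg)
| all (phi : form Sg)
| ex (phi : form Sg).

Record model (Sg : signature) : Type := Model {
  domain :> Type;
  fun_int : forall f : fun_sym Sg, Vector.t domain (fun_ar f) -> domain;
  pred_int : forall P : pred_sym Sg, Vector.t domain (pred_ar P) -> Prop
}.

Fixpoint eval (Sg : signature) (M : model Sg) (rho : nat -> M)
    (t : term Sg) : M :=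
  match t with
  | var _ n => rho n
  | func ts => fun_int (Vector.map (eval rho) ts)
  end.

Definition scons (A : Type) (a : A) (rho : nat -> A) (n : nat) : A :=
  match n with
  | 0 => a
  | S m => rho m
  end.

Fixpoint sat (Sg : signature) (M : model Sg) (rho : nat -> M)
    (phi : form Sg) : Prop :=
  match phi with
  | bot _ => False
  | atom ts => pred_int (Vector.map (eval rho) ts)
  | and_ phi psi => sat rho phi /\ sat rho psi
  | or_ phi psi => sat rho phi \/ sat rho psi
  | imp phi psi => sat rho phi -> sat rho psi
  | all phi => forall a : M, sat (scons a rho) phi
  | ex phi => exists a : M, sat (scons a rho) phi
  end.

Definition elementary_embedding (Sg : signature) (N M : model Sg)
    (h : N -> M) : Prop :=
  forall (rho : nat -> N) (phi : form Sg),
    sat rho phi <-> sat (fun n => h (rho n)) phi.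

(* Countability is required of the sum of the two symbol types, so that
   signatures with only function or only predicate symbols are covered.
   Models are inhabited: a countable type is inhabited (by [j 0]), hence so is
   any model into which it embeds. *)
Definition DLS : Prop :=
  forall (Sg : signature) (M : model Sg),
    countable (fun_sym Sg + pred_sym Sg) ->
    inhabited M ->
    exists (N : model Sg) (h : N -> M),
      countable N /\ elementary_embedding h.

(* Main.v *)
(* A countable elementary submodel is the syntactic model of terms evaluated in
   an environment [rho : nat -> M], provided [rho] is "blurred Henkin": a
   quantified formula over parameters from [rho] is decided by its instances at
   all the [rho n] together, rather than by a single witness.  BDP and BEP
   provide, for one formula, a sequence of elements that decides it; countable
   choice merges these sequences over all formulas into one environment that
   decides the formulas over a previous environment; DC iterates this, and the
   union of the resulting chain decides its own formulas because a formula
   mentions finitely many variables, hence lives at a finite stage. *)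
From Stdlib Require Import Vector Cantor PeanoNat Lia.
Require Import Defs.

Set Implicit Arguments.
Unset Strict Implicit.

(** * Consequences of the choice principles *)

(* DC does not prescribe the first element of its sequence, so it is applied to
   choice functions on initial segments of unspecified length. *)
Lemma DC_countable_choice (B : Type) (Q : nat -> B -> Prop) :
  DC -> (forall n, exists y, Q n y) -> exists g : nat -> B, forall n, Q n (g n).
Proof.
  intros dc total.
  pose (A := {p : nat * (nat -> B) | forall k, k < fst p -> Q k (snd p k)}).
  destruct (dc A (fun p q => fst (proj1_sig q) = S (fst (proj1_sig p))))
    as [f step].
  - destruct (total 0) as [y _].
    constructor; exists (0, fun _ => y); simpl; lia.
  - intros [[n g] Hg]; simpl in Hg.
    destruct (total n) as [y Hy].
    assert (Hg' : forall k, k < S n -> Q k (if k =? n then y else g k)).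
    { intros k Hk; destruct (Nat.eqb_spec k n) as [-> | Hne]; [exact Hy |].
      apply Hg; lia. }
    exists (exist (fun p : nat * (nat -> B) =>
                     forall k, k < fst p -> Q k (snd p k))
              (S n, fun k => if k =? n then y else g k) Hg').
    reflexivity.
  - assert (long : forall k, k <= fst (proj1_sig (f k))).
    { induction k as [| k IH]; [lia |]; rewrite step; lia. }
    (* Successive choice functions need not agree: the value at [k] is read off stage [S k], whose
       length exceeds [k]. *)
    exists (fun k => snd (proj1_sig (f (S k))) k); intro k.
    apply (proj2_sig (f (S k))), long.
Qed.

(** The converse implications are trivial, so for [P] both quantifiers over [A] may be replaced by
    quantifiers along [f]. *)
Definition decides (A : Type) (f : nat -> A) (P : A -> Prop) : Prop :=
  ((forall n, P (f n)) -> forall x, P x) /\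
  ((exists x, P x) -> exists n, P (f n)).

(** Both halves survive an enlargement of the range of the sequence, which is what allows many
    sequences to be merged into one. *)
Lemma decides_incl (A : Type) (f g : nat -> A) (P : A -> Prop) :
  (forall n, exists m, g m = f n) -> decides f P -> decides g P.
Proof.
  intros incl [Hall Hex]; split.
  - intro H; apply Hall; intro n.
    destruct (incl n) as [m <-]; apply H.
  - intro H; destruct (Hex H) as [n Hn].
    destruct (incl n) as [m Hm]; exists m; rewrite Hm; exact Hn.
Qed.

Lemma decides_iff (A : Type) (f : nat -> A) (P Q : A -> Prop) :
  (forall x, P x <-> Q x) -> decides f P -> decides f Q.
Proof.
  intros PQ [Hall Hex]; split.
  - intros H x; apply PQ, Hall; intro n; apply PQ, H.
  - intros [x Hx]; destruct Hex as [n Hn].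
    + exists x; apply PQ, Hx.
    + exists n; apply PQ, Hn.
Qed.

Lemma decides_exists (A : Type) (P : A -> Prop) :
  BDP -> BEP -> inhabited A -> exists f, decides f P.
Proof.
  intros bdp bep inh.
  destruct (bdp A P inh) as [f Hf], (bep A P inh) as [g Hg].
  (* Row 0 of the pairing carries the BDP sequence, every other row the BEP sequence. *)
  exists (fun n => match of_nat n with (0, k) => f k | (_, k) => g k end); split.
  - intro H; apply Hf; intro k.
    specialize (H (to_nat (0, k))); rewrite cancel_of_to in H; exact H.
  - intro H; destruct (Hg H) as [k Hk].
    exists (to_nat (1, k)); rewrite cancel_of_to; exact Hk.
Qed.

(** * Enumeration of terms and formulas *)

(** The hypotheses for the terms inside an argument vector come from an inner induction on that
    vector, with [IH] called on its entries. *)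
Lemma term_nested_ind (Sg : signature) (P : term Sg -> Prop) :
  (forall n, P (var Sg n)) ->
  (forall f (ts : Vector.t (term Sg) (fun_ar f)),
      Vector.Forall P ts -> P (func ts)) ->
  forall t, P t.
Proof.
  intros Hvar Hfunc.
  fix IH 1; intros [n | f ts].
  - apply Hvar.
  - apply Hfunc; induction ts as [| t n ts IHts]; constructor.
    + apply IH.
    + exact IHts.
Qed.

Fixpoint vec_code (n : nat) (v : Vector.t nat n) : nat :=
  match v with
  | Vector.nil _ => 0
  | Vector.cons _ a _ v => to_nat (a, vec_code v)
  end.

Fixpoint vec_decode (A : Type) (dec : nat -> A) (n c : nat) : Vector.t A n :=
  match n with
  | 0 => Vector.nil A
  | S n => let (a, c) := of_nat c in Vector.cons A (dec a) n (vec_decode dec n c)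
  end.

(** Pairing dominates its components, so every entry has a code below [d]; correctness of [dec]
    below [d], as a decoder with limited fuel provides, is therefore enough. *)
Lemma vec_code_decode (A : Type) (enc : A -> nat) (dec : nat -> A) (d n : nat)
    (v : Vector.t A n) :
  Vector.Forall (fun a => enc a < d -> dec (enc a) = a) v ->
  vec_code (Vector.map enc v) < d ->
  vec_decode dec n (vec_code (Vector.map enc v)) = v.
Proof.
  induction 1 as [| n a v Ha _ IH]; [reflexivity |].
  cbn [Vector.map vec_code vec_decode]; intro lt.
  pose proof (to_nat_non_decreasing (enc a) (vec_code (Vector.map enc v))).
  rewrite cancel_of_to, Ha, IH by lia; reflexivity.
Qed.

Fixpoint term_code (Sg : signature) (i : fun_sym Sg + pred_sym Sg -> nat)
    (t : term Sg) : nat :=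
  match t with
  | var _ n => to_nat (0, n)
  | @func _ f ts => to_nat (S (i (inl f)), vec_code (Vector.map (term_code i) ts))
  end.

(* The fuel [d] has to exceed the code [c]. *)
Fixpoint term_decode (Sg : signature) (j : nat -> fun_sym Sg + pred_sym Sg)
    (d c : nat) : term Sg :=
  match d with
  | 0 => var Sg 0
  | S d =>
      match of_nat c with
      | (0, n) => var Sg n
      | (S s, c) =>
          match j s with
          | inl f => func (vec_decode (term_decode j d) (fun_ar f) c)
          | inr _ => var Sg 0
          end
      end
  end.

Lemma term_code_decode (Sg : signature) (i : fun_sym Sg + pred_sym Sg -> nat)
    (j : nat -> fun_sym Sg + pred_sym Sg) :
  (forall s, j (i s) = s) ->
  forall t d, term_code i t < d -> term_decode j d (term_code i t) = t.
Proof.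
  intros ji t.
  induction t as [n | f ts IH] using term_nested_ind;
    intros [| d] lt; try lia; cbn [term_code term_decode] in *;
    rewrite cancel_of_to; [reflexivity |].
  rewrite ji; f_equal.
  (* The successor in the head makes the argument code strictly smaller than the term code, so the
     remaining fuel [d] still exceeds it. *)
  pose proof (to_nat_non_decreasing (S (i (inl f)))
                (vec_code (Vector.map (term_code i) ts))).
  apply vec_code_decode with (d := d); [| lia].
  eapply Vector.Forall_impl; [| exact IH]; auto.
Qed.

Lemma countable_term (Sg : signature) :
  countable (fun_sym Sg + pred_sym Sg) -> countable (term Sg).
Proof.
  intros (i & j & ji).
  exists (term_code i), (fun c => term_decode j (S c) c).
  intro t; apply term_code_decode; [exact ji | lia].
Qed.

Fixpoint form_code (Sg : signature) (i : pred_sym Sg -> nat)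
    (it : term Sg -> nat) (phi : form Sg) : nat :=
  match phi with
  | bot _ => to_nat (0, 0)
  | @atom _ P ts => to_nat (1, to_nat (i P, vec_code (Vector.map it ts)))
  | and_ phi psi => to_nat (2, to_nat (form_code i it phi, form_code i it psi))
  | or_ phi psi => to_nat (3, to_nat (form_code i it phi, form_code i it psi))
  | imp phi psi => to_nat (4, to_nat (form_code i it phi, form_code i it psi))
  | all phi => to_nat (5, form_code i it phi)
  | ex phi => to_nat (6, form_code i it phi)
  end.

Fixpoint form_decode (Sg : signature) (j : nat -> fun_sym Sg + pred_sym Sg)
    (jt : nat -> term Sg) (d c : nat) : form Sg :=
  match d with
  | 0 => bot Sg
  | S d =>
      let (tag, c) := of_nat c in
      let (a, b) := of_nat c in
      match tag with
      | 0 => bot Sg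
      | 1 =>
          match j a with
          | inl _ => bot Sg
          | inr P => atom (vec_decode jt (pred_ar P) b)
          end
      | 2 => and_ (form_decode j jt d a) (form_decode j jt d b)
      | 3 => or_ (form_decode j jt d a) (form_decode j jt d b)
      | 4 => imp (form_decode j jt d a) (form_decode j jt d b)
      | 5 => all (form_decode j jt d c)
      | _ => ex (form_decode j jt d c)
      end
  end.

Lemma form_code_decode (Sg : signature) (i : fun_sym Sg + pred_sym Sg -> nat)
    (j : nat -> fun_sym Sg + pred_sym Sg) (it : term Sg -> nat)
    (jt : nat -> term Sg) :
  (forall s, j (i s) = s) -> (forall t, jt (it t) = t) ->
  forall phi d, form_code (fun P => i (inr P)) it phi < d ->
    form_decode j jt d (form_code (fun P => i (inr P)) it phi) = phi.
Proof.
  intros ji jit phi.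
  set (ip := fun P => i (inr P)).
  induction phi as [| P ts | phi IH1 psi IH2 | phi IH1 psi IH2 | phi IH1 psi IH2
                   | phi IH | phi IH];
    intros [| d] lt; try lia; cbn [form_code form_decode] in *;
    rewrite cancel_of_to.
  - destruct (of_nat 0); reflexivity.
  - rewrite cancel_of_to; unfold ip; rewrite ji; f_equal.
    (* Here [jt] inverts [it] on every term, so any bound above the code of the vector will do. *)
    apply vec_code_decode with (d := S (vec_code (Vector.map it ts))); [| lia].
    apply Vector.Forall_forall; auto.
  - pose proof (to_nat_non_decreasing 2
      (to_nat (form_code ip it phi, form_code ip it psi))).
    pose proof (to_nat_non_decreasing (form_code ip it phi) (form_code ip it psi)).
    rewrite cancel_of_to, IH1, IH2 by lia; reflexivity.
  - pose proof (to_nat_non_decreasing 3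
      (to_nat (form_code ip it phi, form_code ip it psi))).
    pose proof (to_nat_non_decreasing (form_code ip it phi) (form_code ip it psi)).
    rewrite cancel_of_to, IH1, IH2 by lia; reflexivity.
  - pose proof (to_nat_non_decreasing 4
      (to_nat (form_code ip it phi, form_code ip it psi))).
    pose proof (to_nat_non_decreasing (form_code ip it phi) (form_code ip it psi)).
    rewrite cancel_of_to, IH1, IH2 by lia; reflexivity.
  - pose proof (to_nat_non_decreasing 5 (form_code ip it phi)).
    (* The decoder unpairs the payload before it inspects the tag, hence the [destruct] that lets
       the match reduce. *)
    rewrite IH by lia; destruct (of_nat (form_code ip it phi)); reflexivity.
  - pose proof (to_nat_non_decreasing 6 (form_code ip it phi)).
    rewrite IH by lia; destruct (of_nat (form_code ip it phi)); reflexivity.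
Qed.

Lemma countable_form (Sg : signature) :
  countable (fun_sym Sg + pred_sym Sg) -> countable (form Sg).
Proof.
  intro cSg; destruct (countable_term cSg) as (it & jt & jit).
  destruct cSg as (i & j & ji).
  exists (form_code (fun P => i (inr P)) it), (fun c => form_decode j jt (S c) c).
  intro phi; apply form_code_decode; auto.
Qed.

(** * Finitely many variables, and substitution *)

Definition finite_dep (A B : Type) (F : (nat -> A) -> B) : Prop :=
  exists m, forall rho rho', (forall p, p < m -> rho p = rho' p) -> F rho = F rho'.

Lemma map_eval_finite (Sg : signature) (M : model Sg) (n : nat)
    (ts : Vector.t (term Sg) n) :
  Vector.Forall (fun t => finite_dep (fun rho : nat -> M => eval rho t)) ts ->
  finite_dep (fun rho : nat -> M => Vector.map (eval rho) ts).
Proof.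
  induction 1 as [| n t ts [m1 H1] _ [m2 H2]].
  - exists 0; reflexivity.
  - exists (max m1 m2); intros rho rho' H; simpl.
    f_equal; [apply H1 | apply H2]; intros p Hp; apply H; lia.
Qed.

Lemma eval_finite (Sg : signature) (M : model Sg) (t : term Sg) :
  finite_dep (fun rho : nat -> M => eval rho t).
Proof.
  induction t as [n | f ts IH] using term_nested_ind.
  - exists (S n); intros rho rho' H; apply H; lia.
  - destruct (map_eval_finite IH) as [m Hm].
    exists m; intros rho rho' H; simpl; f_equal; apply Hm, H.
Qed.

Lemma scons_agree (A : Type) (a : A) (rho rho' : nat -> A) (m : nat) :
  (forall p, p < m -> rho p = rho' p) ->
  forall p, p < m -> scons a rho p = scons a rho' p.
Proof. intros H [| p] Hp; [reflexivity | apply H; lia]. Qed.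

(** The equality of [finite_dep] becomes an equivalence, since equality of propositions would call
    for propositional extensionality. A quantified formula keeps the bound of its body, by
    [scons_agree]. *)
Lemma sat_finite (Sg : signature) (M : model Sg) (phi : form Sg) :
  exists m, forall rho rho' : nat -> M,
    (forall p, p < m -> rho p = rho' p) -> sat rho phi <-> sat rho' phi.
Proof.
  induction phi as [| P ts | phi [m1 H1] psi [m2 H2] | phi [m1 H1] psi [m2 H2]
                   | phi [m1 H1] psi [m2 H2] | phi [m H] | phi [m H]]; simpl.
  - exists 0; tauto.
  - destruct (@map_eval_finite Sg M _ ts) as [m H].
    { apply Vector.Forall_forall; intros t _; apply eval_finite. }
    exists m; intros rho rho' Hr; rewrite (H _ _ Hr); tauto.
  - exists (max m1 m2); intros rho rho' Hr.
    rewrite (H1 rho rho'), (H2 rho rho') by (intros; apply Hr; lia); tauto.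
  - exists (max m1 m2); intros rho rho' Hr.
    rewrite (H1 rho rho'), (H2 rho rho') by (intros; apply Hr; lia); tauto.
  - exists (max m1 m2); intros rho rho' Hr.
    rewrite (H1 rho rho'), (H2 rho rho') by (intros; apply Hr; lia); tauto.
  - exists m; intros rho rho' Hr.
    split; intros Ha a; apply (H _ _ (scons_agree a Hr)), Ha.
  - exists m; intros rho rho' Hr.
    split; intros [a Ha]; exists a; apply (H _ _ (scons_agree a Hr)), Ha.
Qed.

(** Pointwise agreement covers the finitely many variables that matter, which avoids functional
    extensionality. *)
Lemma eval_ext (Sg : signature) (M : model Sg) (rho rho' : nat -> M) (t : term Sg) :
  (forall p, rho p = rho' p) -> eval rho t = eval rho' t.
Proof. intro H; destruct (eval_finite M t) as [m Hm]; auto. Qed.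

Lemma sat_ext (Sg : signature) (M : model Sg) (rho rho' : nat -> M) (phi : form Sg) :
  (forall p, rho p = rho' p) -> sat rho phi <-> sat rho' phi.
Proof. intro H; destruct (sat_finite M phi) as [m Hm]; auto. Qed.

Fixpoint term_subst (Sg : signature) (s : nat -> term Sg) (t : term Sg) : term Sg :=
  match t with
  | var _ n => s n
  | func ts => func (Vector.map (term_subst s) ts)
  end.

Definition lift_subst (Sg : signature) (s : nat -> term Sg) : nat -> term Sg :=
  scons (var Sg 0) (fun n => term_subst (fun p => var Sg (S p)) (s n)).

Fixpoint form_subst (Sg : signature) (s : nat -> term Sg) (phi : form Sg) : form Sg :=
  match phi with
  | bot _ => bot Sg
  | atom ts => atom (Vector.map (term_subst s) ts)
  | and_ phi psi => and_ (form_subst s phi) (form_subst s psi)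
  | or_ phi psi => or_ (form_subst s phi) (form_subst s psi)
  | imp phi psi => imp (form_subst s phi) (form_subst s psi)
  | all phi => all (form_subst (lift_subst s) phi)
  | ex phi => ex (form_subst (lift_subst s) phi)
  end.

Lemma eval_subst (Sg : signature) (M : model Sg) (rho : nat -> M)
    (s : nat -> term Sg) (t : term Sg) :
  eval rho (term_subst s t) = eval (fun n => eval rho (s n)) t.
Proof.
  induction t as [n | f ts IH] using term_nested_ind; [reflexivity |].
  simpl; f_equal; rewrite Vector.map_map.
  induction IH as [| n t ts Ht _ IHts]; simpl; f_equal; auto.
Qed.

Lemma eval_lift_subst (Sg : signature) (M : model Sg) (rho : nat -> M)
    (s : nat -> term Sg) (a : M) (p : nat) :
  eval (scons a rho) (lift_subst s p) = scons a (fun n => eval rho (s n)) p.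
Proof.
  destruct p as [| p]; [reflexivity |].
  unfold lift_subst; simpl; rewrite eval_subst; apply eval_ext; reflexivity.
Qed.

Lemma sat_subst (Sg : signature) (M : model Sg) (phi : form Sg) :
  forall (rho : nat -> M) (s : nat -> term Sg),
    sat rho (form_subst s phi) <-> sat (fun n => eval rho (s n)) phi.
Proof.
  induction phi as [| P ts | phi IH1 psi IH2 | phi IH1 psi IH2 | phi IH1 psi IH2
                   | phi IH | phi IH]; intros rho s; simpl.
  - tauto.
  - rewrite Vector.map_map.
    rewrite (Vector.map_ext _ _ _ _ (eval_subst rho s)); tauto.
  - rewrite IH1, IH2; tauto.
  - rewrite IH1, IH2; tauto.
  - rewrite IH1, IH2; tauto.
  - split; intros H a; specialize (H a); [rewrite IH in H | rewrite IH];
      apply (sat_ext phi (eval_lift_subst rho s a)), H.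
  - split; intros [a H]; exists a; [rewrite IH in H | rewrite IH];
      apply (sat_ext phi (eval_lift_subst rho s a)), H.
Qed.

(** Parameters that are values of terms under [rho] can be absorbed into the formula; a property of
    all formulas over [rho] thus extends to such parameters. *)
Lemma sat_scons_subst (Sg : signature) (M : model Sg) (rho : nat -> M)
    (s : nat -> term Sg) (a : M) (phi : form Sg) :
  sat (scons a rho) (form_subst (lift_subst s) phi) <->
  sat (scons a (fun n => eval rho (s n))) phi.
Proof. rewrite sat_subst; apply sat_ext, eval_lift_subst. Qed.

(** * Blurred Henkin environments *)

(** [rho] supplies the parameters and [rho'] the instances; the blurred Henkin environments are the
    [rho] with [henkin rho rho]. *)
Definition henkin (Sg : signature) (M : model Sg) (rho rho' : nat -> M) : Prop :=
  forall phi : form Sg, decides rho' (fun a => sat (scons a rho) phi).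

Lemma henkin_extension (Sg : signature) (M : model Sg) (rho : nat -> M) :
  DC -> BDP -> BEP -> countable (form Sg) -> inhabited M ->
  exists rho', (forall n, rho' (to_nat (0, n)) = rho n) /\ henkin rho rho'.
Proof.
  intros dc bdp bep (i & j & ji) inh.
  destruct (@DC_countable_choice (nat -> M)
    (fun c f => decides f (fun a => sat (scons a rho) (j c))) dc) as [g Hg].
  { intro c; apply decides_exists; assumption. }
  (* Row 0 keeps the old environment, row [S c] holds the sequence for the formula with code [c]. *)
  exists (fun x => match of_nat x with (0, n) => rho n | (S c, n) => g c n end).
  split.
  - intro n; rewrite cancel_of_to; reflexivity.
  - intro phi; apply decides_incl with (f := g (i phi)).
    + intro n; exists (to_nat (S (i phi), n)); rewrite cancel_of_to; reflexivity.
    + specialize (Hg (i phi)); rewrite ji in Hg; exact Hg.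
Qed.

Lemma henkin_environment (Sg : signature) (M : model Sg) :
  DC -> BDP -> BEP -> countable (form Sg) -> inhabited M ->
  exists rho : nat -> M, henkin rho rho.
Proof.
  intros dc bdp bep cf inh.
  destruct (dc (nat -> M) (fun rho rho' =>
    (forall n, rho' (to_nat (0, n)) = rho n) /\ henkin rho rho')) as [F HF].
  - destruct inh as [a]; constructor; exact (fun _ => a).
  - intro rho; apply henkin_extension; assumption.
  - assert (mono : forall k l n, k <= l -> exists n', F l n' = F k n).
    { intros k l n Hkl; induction Hkl as [| l _ [n' IH]].
      - exists n; reflexivity.
      - exists (to_nat (0, n')); rewrite (proj1 (HF l)); exact IH. }
    set (rho := fun p => let (k, n) := of_nat p in F k n).
    exists rho; intro phi.
    (* Each finite segment of the union lies, up to the reindexing [xi], in a single stage of the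
       chain. *)
    assert (stage : forall m, exists K xi, forall p, p < m -> rho p = F K (xi p)).
    { induction m as [| m (K & xi & H)].
      - exists 0, (fun p => p); lia.
      - unfold rho; destruct (of_nat m) as [k n] eqn:E.
        destruct (mono k (max k K) n) as [n' Hn']; [lia |].
        (* [mono] yields only the existence of a new index for each [p]; finitely many of them are
           collected into a function by induction on the length. *)
        assert (exists xi', forall p, p < m -> rho p = F (max k K) (xi' p))
          as [xi' H'].
        { clear E; induction m as [| m IHm].
          - exists xi; lia.
          - destruct IHm as [xi' H']; [intros p Hp; apply H; lia |].
            destruct (mono K (max k K) (xi m)) as [q Hq]; [lia |].
            exists (fun p => if p =? m then q else xi' p); intros p Hp.
            destruct (Nat.eqb_spec p m) as [-> | Hne].
            + rewrite Hq; apply H; lia.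
            + apply H'; lia. }
        exists (max k K), (fun p => if p =? m then n' else xi' p); intros p Hp.
        destruct (Nat.eqb_spec p m) as [-> | Hne].
        + rewrite E, Hn'; reflexivity.
        + apply H'; lia. }
    destruct (sat_finite M phi) as [m Hm], (stage m) as (K & xi & Hxi).
    apply decides_incl with (f := F (S K)).
    { intro n; exists (to_nat (S K, n)); unfold rho.
      rewrite cancel_of_to; reflexivity. }
    (* Renaming variables along [xi] turns [phi] over [rho] into a formula over stage [K], which
       stage [S K] decides. *)
    apply decides_iff with
      (2 := proj2 (HF K) (form_subst (lift_subst (fun p => var Sg (xi p))) phi)).
    intro a; rewrite sat_scons_subst; apply Hm, scons_agree.
    intros p Hp; symmetry; apply Hxi, Hp.
Qed.

(** * The syntactic model *)

(** As the logic has no equality, terms with the same value under [rho] need not be identified, and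
    no quotient is formed. *)
Definition term_model (Sg : signature) (M : model Sg) (rho : nat -> M) : model Sg :=
  @Model Sg (term Sg) (@func Sg)
    (fun P ts => pred_int (Vector.map (eval rho) ts)).

Lemma eval_term_model (Sg : signature) (M : model Sg) (rho : nat -> M)
    (s : nat -> term Sg) (t : term Sg) :
  eval rho (eval (M := term_model rho) s t) = eval (fun n => eval rho (s n)) t.
Proof.
  induction t as [n | f ts IH] using term_nested_ind; [reflexivity |].
  simpl; f_equal; rewrite Vector.map_map.
  induction IH as [| n t ts Ht _ IHts]; simpl; f_equal; auto.
Qed.

Lemma henkin_elementary (Sg : signature) (M : model Sg) (rho : nat -> M) :
  henkin rho rho ->
  elementary_embedding (N := term_model rho) (M := M) (eval rho).
Proof.
  intros hk s phi; revert s.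
  assert (inst : forall (phi' : form Sg),
    (forall s : nat -> term_model rho,
      sat s phi' <-> sat (fun n => eval rho (s n)) phi') ->
    forall (s : nat -> term_model rho) (t : term_model rho),
      sat (scons t s) phi' <->
      sat (scons (eval rho t) (fun n => eval rho (s n))) phi').
  { intros phi' IH s t; rewrite IH; apply sat_ext; intros [| p]; reflexivity. }
  (* Parameters from the term model are terms; substituting them into [phi'] reduces the claim to
     the parameters of [rho] itself. *)
  assert (blurred : forall (phi' : form Sg) (s : nat -> term Sg),
    decides rho (fun a => sat (scons a (fun n => eval rho (s n))) phi')).
  { intros phi' s.
    apply decides_iff with (2 := hk (form_subst (lift_subst s) phi')).
    intro a; apply sat_scons_subst. }
  induction phi as [| P ts | phi IH1 psi IH2 | phi IH1 psi IH2 | phi IH1 psi IH2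
                   | phi IH | phi IH]; intro s; simpl.
  - tauto.
  - rewrite Vector.map_map.
    rewrite (Vector.map_ext _ _ _ _ (eval_term_model rho s)); tauto.
  - rewrite IH1, IH2; tauto.
  - rewrite IH1, IH2; tauto.
  - rewrite IH1, IH2; tauto.
  - split.
    (* Only the instances at variables are used: [var Sg n] evaluates to [rho n], and these values
       decide the formula. *)
    + intro H; apply (proj1 (blurred phi s)); intro n.
      apply (inst _ IH s (var Sg n)), H.
    + intros H t; apply (inst _ IH), H.
  - split.
    + intros [t H]; exists (eval rho t); apply (inst _ IH), H.
    + intro H; destruct (proj2 (blurred phi s) H) as [n Hn].
      exists (var Sg n); apply (inst _ IH s (var Sg n)), Hn.
Qed.

Theorem theorem6p3 : DC -> BDP -> BEP -> DLS.
Proof.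
  intros dc bdp bep Sg M cSg inh.
  destruct (henkin_environment dc bdp bep (countable_form cSg) inh) as [rho hk].
  exists (term_model rho), (eval rho); split.
  - exact (countable_term cSg).
  - exact (henkin_elementary hk).
Qed.
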